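(* If $i_1,i_1',i_2,\ldots,i_m$ are distinct integers, then $$\sum_{n=0}^{\infty}\bigl(G_{n+i_1}-G_{n+i_1'}\bigr)\,G_{n+i_2}G_{n+i_3}\cdots G_{n+i_m}$$ is a rational function of $C$.
   Context: Paths use steps $(1,1)$ and $(1,-1)$; a Dyck path of semilength $n$ starts at $(0,0)$, ends at $(2n,0)$ and never goes below level ($y$-coordinate) $0$; its height is the maximum level reached (the empty path has height $0$). Let $c(x)=\sum_{n\ge0}\frac{1}{n+1}\binom{2n}{n}x^n=\frac{1-\sqrt{1-4x}}{2x}$ and $C=c(x)-1=xc(x)^2$. For an integer $k$, $G_k=\sum_P x^{\text{semilength}(P)}$, the sum over all Dyck paths $P$ of height at most $k$ (so $G_k=0$ for $k<0$). The sum is a formal power series in $x$ (convergent $x$-adically), and the claim is that it equals $Q(C)$ for some rational function $Q$. *)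

(* Defs.v *)
From HB Require Import structures.
From mathcomp Require Import all_boot all_order all_algebra.
From mathcomp Require Import boolp zify.

Set Implicit Arguments.
Unset Strict Implicit.
Unset Printing Implicit Defensive.

Import Order.TTheory GRing.Theory Num.Theory.
Local Open Scope ring_scope.

(* K[[x]]: [f n] is the coefficient of x^n.  A record rather than a bare      *)
(* function type, so that the Cauchy product below does not clash with the    *)
(* pointwise structures on functions.                                         *)
Record fps (K : fieldType) := Fps { coefs :> nat -> K }.

HB.instance Definition _ (K : fieldType) := gen_eqMixin (fps K).
HB.instance Definition _ (K : fieldType) := gen_choiceMixin (fps K).

Section FpsRing.
Variable K : fieldType.
Implicit Types (f g h : fps K) (a b : K).

Lemma fpsP f g : f =1 g -> f = g.
Proof. by case: f g => [f] [g] /= /funext ->. Qed.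

Definition fps_zero : fps K := Fps (fun=> 0).
Definition fps_opp f : fps K := Fps (fun n => - f n).
Definition fps_add f g : fps K := Fps (fun n => f n + g n).
Definition fps_one : fps K := Fps (fun n => (n == 0)%:R).
Definition fps_mul f g : fps K :=
  Fps (fun n => \sum_(i < n.+1) f i * g (n - i)%N).
Definition fps_scale a f : fps K := Fps (fun n => a * f n).

Fact fps_addA : associative fps_add.
Proof. by move=> f g h; apply: fpsP => n /=; rewrite addrA. Qed.
Fact fps_addC : commutative fps_add.
Proof. by move=> f g; apply: fpsP => n /=; rewrite addrC. Qed.
Fact fps_add0 : left_id fps_zero fps_add.
Proof. by move=> f; apply: fpsP => n /=; rewrite add0r. Qed.
Fact fps_addN : left_inverse fps_zero fps_opp fps_add.
Proof. by move=> f; apply: fpsP => n /=; rewrite addNr. Qed.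

HB.instance Definition _ :=
  GRing.isZmodule.Build (fps K) fps_addA fps_addC fps_add0 fps_addN.

Definition fps_trunc N f : {poly K} := \poly_(i < N) f i.

Lemma coef_fps_mul N n f g (p q : {poly K}) : (n < N)%N ->
  (forall i, (i < N)%N -> f i = p`_i) -> (forall i, (i < N)%N -> g i = q`_i) ->
  fps_mul f g n = (p * q)`_n.
Proof.
move=> ltnN fp gq; rewrite coefM; apply: eq_bigr => i _.
by rewrite fp ?gq ?(leq_ltn_trans _ ltnN) ?leq_subr // -ltnS.
Qed.

Lemma coef_fps_trunc N i f : (i < N)%N -> f i = (fps_trunc N f)`_i.
Proof. by move=> ltiN; rewrite coef_poly ltiN. Qed.

Fact fps_mulA : associative fps_mul.
Proof.
move=> f g h; apply: fpsP => n; have E := @coef_fps_trunc n.+1.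
have M u v i : (i < n.+1)%N ->
    fps_mul u v i = (fps_trunc n.+1 u * fps_trunc n.+1 v)`_i.
  by move=> lti; apply: (coef_fps_mul lti) => j; apply: E.
rewrite (coef_fps_mul (ltnSn n) (E ^~ f) (M g h)).
by rewrite (coef_fps_mul (ltnSn n) (M f g) (E ^~ h)) mulrA.
Qed.
Fact fps_mulC : commutative fps_mul.
Proof.
move=> f g; apply: fpsP => n; have E := @coef_fps_trunc n.+1.
rewrite (coef_fps_mul (ltnSn n) (E ^~ f) (E ^~ g)).
by rewrite (coef_fps_mul (ltnSn n) (E ^~ g) (E ^~ f)) mulrC.
Qed.
Fact fps_mul1 : left_id fps_one fps_mul.
Proof.
move=> f; apply: fpsP => n; rewrite /= big_ord_recl mul1r subn0.
by rewrite big1 ?addr0 // => i _; rewrite mul0r.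
Qed.
Fact fps_mulDl : left_distributive fps_mul fps_add.
Proof.
move=> f g h; apply: fpsP => n /=; rewrite -big_split /=.
by apply: eq_bigr => i _; rewrite mulrDl.
Qed.
Fact fps_one_neq0 : fps_one != 0.
Proof.
apply/eqP => /(congr1 (fun f : fps K => f 0%N)) /= /eqP.
by rewrite oner_eq0.
Qed.

HB.instance Definition _ := GRing.Zmodule_isComNzRing.Build (fps K)
  fps_mulA fps_mulC fps_mul1 fps_mulDl fps_one_neq0.

Fact fps_scaleA a b f : fps_scale a (fps_scale b f) = fps_scale (a * b) f.
Proof. by apply: fpsP => n /=; rewrite mulrA. Qed.
Fact fps_scale1 : left_id 1 fps_scale.
Proof. by move=> f; apply: fpsP => n /=; rewrite mul1r. Qed.
Fact fps_scaleDr : right_distributive fps_scale +%R.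
Proof. by move=> a f g; apply: fpsP => n /=; rewrite mulrDr. Qed.
Fact fps_scaleDl f : {morph fps_scale^~ f : a b / a + b}.
Proof. by move=> a b; apply: fpsP => n /=; rewrite mulrDl. Qed.

HB.instance Definition _ := GRing.Zmodule_isLmodule.Build K (fps K)
  fps_scaleA fps_scale1 fps_scaleDr fps_scaleDl.

Fact fps_scaleAl a f g : a *: (f * g) = (a *: f) * g.
Proof.
apply: fpsP => n; rewrite /= mulr_sumr.
by apply: eq_bigr => i _; rewrite mulrA.
Qed.

HB.instance Definition _ :=
  GRing.Lmodule_isLalgebra.Build K (fps K) fps_scaleAl.
HB.instance Definition _ := GRing.Lalgebra_isComAlgebra.Build K (fps K).

Lemma coef_fpsD f g n : (f + g) n = f n + g n. Proof. by []. Qed.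
Lemma coef_fpsN f n : (- f) n = - f n. Proof. by []. Qed.
Lemma coef_fpsB f g n : (f - g) n = f n - g n. Proof. by []. Qed.
Lemma coef_fpsZ a f n : (a *: f) n = a * f n. Proof. by []. Qed.
Lemma coef_fps0 n : (0 : fps K) n = 0. Proof. by []. Qed.
Lemma coef_fps1 n : (1 : fps K) n = (n == 0)%:R. Proof. by []. Qed.
Lemma coef_fpsM f g n : (f * g) n = \sum_(i < n.+1) f i * g (n - i)%N.
Proof. by []. Qed.
Lemma coef_fps_sum (I : Type) (r : seq I) (P : pred I) (F : I -> fps K) n :
  (\sum_(i <- r | P i) F i) n = \sum_(i <- r | P i) F i n.
Proof. by elim/big_rec2: _ => // i u v _ <-. Qed.

Lemma coef_fpsX_eq0 f k n : f 0%N = 0 -> (n < k)%N -> (f ^+ k) n = 0.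
Proof.
move=> f0; elim: k n => // k IHk n ltnk; rewrite exprS coef_fpsM big1 // => i _.
case: i => [[|i] /= lti]; first by rewrite f0 mul0r.
by rewrite IHk ?mulr0 //; lia.
Qed.

(* Units are the series with nonzero constant term; the inverse is given by   *)
(* the geometric series in 1 - f / f 0.                                       *)
Definition fps_unit : {pred fps K} := fun f => f 0%N != 0.
Definition fps_inv f : fps K :=
  if f 0%N == 0 then f
  else Fps (fun n => (f 0%N)^-1 *
              (\sum_(k < n.+1) (1 - (f 0%N)^-1 *: f) ^+ k) n).

Fact fps_mulVf : {in fps_unit, left_inverse 1 fps_inv *%R}.
Proof.
move=> f; rewrite unfold_in /fps_inv => f0; rewrite (negbTE f0).
set h := 1 - _; have h0 : h 0%N = 0.
  by rewrite /h coef_fpsB coef_fpsZ mulVf // subrr.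
apply: fpsP => n; pose s := \sum_(k < n.+1) h ^+ k.
transitivity ((s * (1 - h)) n); last first.
  rewrite mulrC -[1 - h]opprB mulNr -subrX1 opprB coef_fpsB.
  by rewrite (coef_fpsX_eq0 h0) // subr0.
rewrite !coef_fpsM; apply: eq_bigr => i _.
have -> : (1 - h) = (f 0%N)^-1 *: f by rewrite /h opprB addrC subrK.
rewrite coef_fpsZ mulrCA mulrA; congr (_ * _); congr (_ * _).
rewrite /s !coef_fps_sum -!(big_mkord xpredT (fun k => (h ^+ k) i)).
rewrite [RHS](big_cat_nat (n := i.+1)) //= ?ltnS -?ltnS //.
rewrite [X in _ + X]big_nat_cond [X in _ + X]big1 ?addr0 // => k.
by case/andP => /andP [ltik _] _; rewrite (coef_fpsX_eq0 h0).
Qed.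
Fact fps_unitPl f g : g * f = 1 -> fps_unit f.
Proof.
move=> /(congr1 (fun h : fps K => h 0%N)); rewrite coef_fpsM big_ord1 coef_fps1.
by apply: contra_eqN => /eqP ->; rewrite mulr0 eq_sym oner_eq0.
Qed.
Fact fps_inv_out : {in [predC fps_unit], fps_inv =1 id}.
Proof. by move=> f; rewrite inE unfold_in negbK /fps_inv => ->. Qed.

HB.instance Definition _ := GRing.ComNzRing_hasMulInverse.Build (fps K)
  fps_mulVf fps_unitPl fps_inv_out.

Definition xadic_cvg (u : nat -> fps K) (f : fps K) : Prop :=
  forall d, exists N, forall n, (N <= n)%N -> forall j, (j < d)%N -> u n j = f j.

Definition xadic_sum (t : nat -> fps K) (f : fps K) : Prop :=
  xadic_cvg (fun N => \sum_(0 <= n < N) t n) f.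

(* f = Q(g) with Q = p / q a rational function that can be evaluated at g     *)
(* inside K[[x]], i.e. q(g) is invertible there.  If g has zero constant      *)
(* term, this says q(0) <> 0; no Q is lost this way when g <> 0, since after  *)
(* cancelling common factors a Q with Q(g) in K[[x]] has no pole at 0.        *)
Definition rational_in (g f : fps K) : Prop :=
  exists p q : {poly K},
    horner_alg g q \is a GRing.unit /\ f = horner_alg g p / horner_alg g q.

End FpsRing.

(* A path is its sequence of steps: true is (1,1) and false is (1,-1).        *)
Definition level (p : seq bool) (j : nat) : int :=
  \sum_(b <- take j p) (if b then 1 else -1).

Definition dyck (p : seq bool) : bool :=
  [forall j : 'I_(size p).+1, 0 <= level p j] && (level p (size p) == 0).

Definition height (p : seq bool) : int :=
  \big[Num.max/0]_(j < (size p).+1) level p j.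

Definition G (k : int) : fps rat :=
  Fps (fun n => #|[set p : (n.*2).-tuple bool | dyck p & height p <= k]|%:R).

Definition c : fps rat := Fps (fun n => 'C(n.*2, n)%:R / n.+1%:R).

Definition C : fps rat := c - 1.

(* Main.v *)
(* Idea.  Write q for C, so that x = q / (1 + q)^2.  Counting paths in a strip *)
(* by their starting level gives a linear recurrence, whose solution is       *)
(* G_k = (1 + q) (1 - q^(k+1)) / (1 - q^(k+2)).  Thus G_(n+a) is a            *)
(* homographic function of q^n with one pole, determined by a, and by partial *)
(* fractions (G_(n+a) - G_(n+b)) G_(n+i) is a combination, with coefficients  *)
(* in Q(q) independent of n, of G_(n+a) - G_(n+i) and G_(n+b) - G_(n+i).      *)
(* Iterating removes all the factors G_(n+i_j), and the remaining differences *)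
(* G_(n+a) - G_(n+b) telescope.                                               *)

Require Import Defs.
From mathcomp Require Import all_boot all_order all_algebra.
From mathcomp Require Import boolp zify ring.

Set Implicit Arguments.
Unset Strict Implicit.

Import Order.TTheory GRing.Theory Num.Theory.
Local Open Scope ring_scope.

(** The computation rests on [fpsXE], x (1 + C)^2 = C, which follows from the quadratic equation
    [c_quadratic]. It turns the recurrence on levels into [G_closed], the closed form of G_k; one
    consequence is [coef_G_large]: G_k agrees with 1 + C up to x^k, so the series converges and the
    telescoping sums have limit 1 + C. Partial fractions in C^n give [G_diff_mul], which removes one
    factor at the price of a multiplier such as C (C^a - C^i) (C^b - C^i). This multiplier is
    nonzero because the indices are distinct, but it is not invertible as a power series.
    Rationality is therefore tracked by [ratio_in_C], which allows such denominators, and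
    [rational_in_C] removes the powers of C at the end. Negative indices are reduced to natural ones
    by splitting off finitely many terms. *)

(** * The quadratic equation of the Catalan series *)

Definition fpsX : fps rat := Fps (fun n => (n == 1)%:R).

Lemma coef_fpsXM0 (f : fps rat) : (fpsX * f) 0 = 0.
Proof. by rewrite coef_fpsM big_ord1 mul0r. Qed.

Lemma coef_fpsXMS (f : fps rat) n : (fpsX * f) n.+1 = f n.
Proof.
rewrite coef_fpsM 2!big_ord_recl big1 /= ?mul0r ?mul1r ?add0r ?addr0 ?subn1 //.
by move=> i _; rewrite mul0r.
Qed.

(** The Euler derivation x d/dx, which turns recurrences with coefficients linear in n into
    differential equations. *)
Definition theta (f : fps rat) : fps rat := Fps (fun n => n%:R * f n).

Lemma coef_theta (f : fps rat) n : theta f n = n%:R * f n.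
Proof. by []. Qed.

Lemma thetaM f g : theta (f * g) = theta f * g + f * theta g.
Proof.
apply: fpsP => n; rewrite coef_fpsD !coef_fpsM /= mulr_sumr -big_split /=.
apply: eq_bigr => i _; have le_in : (i <= n)%N by rewrite -ltnS.
by rewrite -{1}(subnKC le_in) natrD; ring.
Qed.

Lemma thetaB f g : theta (f - g) = theta f - theta g.
Proof. by apply: fpsP => n /=; rewrite mulrBr. Qed.

Lemma theta1 : theta 1 = 0.
Proof. by apply: fpsP => -[|n] /=; rewrite ?mul0r ?mulr0. Qed.

Lemma thetaX : theta fpsX = fpsX.
Proof. by apply: fpsP => -[|[|n]] /=; rewrite ?mulr0 ?mulr1. Qed.

Lemma bin_doubleS n : (n.+1 * 'C(n.+1.*2, n.+1) = 2 * (n.*2.+1 * 'C(n.*2, n)))%N.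
Proof.
have e1 := mul_bin_diag n.+1.*2 n; have e2 := mul_bin_down n.*2.+1 n.
have e3 : (n.*2.+1 - n = n.+1)%N by lia.
by rewrite -e1 /= e3 in e2 *; lia.
Qed.

Lemma coef_cM n : n.+1%:R * c n = 'C(n.*2, n)%:R.
Proof. by rewrite /c /= mulrC divfK ?pnatr_eq0. Qed.

Lemma c_rec n : n.+2%:R * c n.+1 = (2 * n.*2.+1)%:R * c n.
Proof.
have n1 : n.+1%:R != 0 :> rat by rewrite pnatr_eq0.
apply: (mulfI n1).
by rewrite coef_cM mulrCA coef_cM -!natrM bin_doubleS mulnA.
Qed.

(* The recurrence (n + 2) c_(n+1) = (4n + 2) c_n as a differential equation. *)
Lemma theta_c : theta c - 4 * (fpsX * theta c) = 1 - c + 2 * (fpsX * c).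
Proof.
apply: fpsP => -[|n]; rewrite !mulr_natl.
  rewrite !mulr2n !mulrS mulr0n !(coef_fpsD, coef_fpsN, coef_fps1, coef_fpsXM0).
  by rewrite coef_fps0 /= mul0r bin0 divr1.
rewrite !mulr2n !mulrS mulr0n !(coef_fpsD, coef_fpsN, coef_fps1, coef_fpsXMS).
have n1 : (n.+1 == 0)%:R = 0 :> rat by [].
rewrite coef_fps0 !coef_theta n1.
have /eqP := c_rec n; rewrite -subr_eq0 => /eqP e.
apply/eqP; rewrite -subr_eq0 -[X in _ == X]e; apply/eqP.
rewrite -muln2 natrM -[n.+2]add2n -[(n * 2).+1]add1n -[n.+1]add1n !natrD natrM.
ring.
Qed.

(** Coefficientwise the equation reads (n + 2) F_(n+1) = 4 n F_n, so zero propagates from F_0. *)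
Lemma theta_ode_eq0 (F : fps rat) :
  F 0 = 0 -> theta F - 4 * (fpsX * theta F) = - F -> F = 0.
Proof.
move=> F0 odeF; apply: fpsP; elim=> [//|n IHn].
have := congr1 (fun f : fps rat => f n.+1) odeF.
rewrite mulr_natl !mulrS mulr0n !(coef_fpsD, coef_fpsN, coef_fpsXMS) !coef_theta.
rewrite IHn !coef_fps0 mulr0 !addr0 => /eqP.
by rewrite -subr_eq0 opprK -[X in _ + X]mul1r -mulrDl natr1 mulf_eq0 pnatr_eq0
  => /eqP ->.
Qed.

(** By [theta_c], the defect c - 1 - x c^2 solves the homogeneous equation of [theta_ode_eq0]. *)
Lemma c_quadratic : c = 1 + fpsX * c ^+ 2.
Proof.
suff F0 : c - 1 - fpsX * c ^+ 2 = 0 by rewrite -[RHS]addr0 -F0; ring.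
apply: theta_ode_eq0.
  by rewrite !coef_fpsB coef_fpsXM0 coef_fps1 subr0 /= bin0 divr1 subrr.
rewrite !thetaB theta1 !thetaM thetaX.
transitivity ((theta c - 4 * (fpsX * theta c)) * (1 - 2 * (fpsX * c))
              - (1 - 4 * fpsX) * (fpsX * c ^+ 2)); first by ring.
by rewrite theta_c; ring.
Qed.

Lemma fpsXE : fpsX * (1 + C) ^+ 2 = C.
Proof. by rewrite /C addrC subrK {2}c_quadratic addrC addKr. Qed.

Lemma C0 : C 0 = 0.
Proof. by rewrite -fpsXE coef_fpsXM0. Qed.

Lemma fps_unitE (f : fps rat) : (f \is a GRing.unit) = (f 0 != 0).
Proof. by []. Qed.

Lemma unit_sub1Cexp k : 1 - C ^+ k.+1 \is a GRing.unit.
Proof. by rewrite fps_unitE coef_fpsB coef_fps1 coef_fpsX_eq0 ?C0. Qed.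

Lemma unit_add1C : 1 + C \is a GRing.unit.
Proof. by rewrite fps_unitE coef_fpsD coef_fps1 C0. Qed.

(** C is x times a unit, and multiplication by x only shifts coefficients. *)
Lemma lreg_C : GRing.lreg C.
Proof.
move=> f g; rewrite -fpsXE -!(mulrA fpsX) => e.
apply: (mulrI (unitrX 2 unit_add1C)); apply: fpsP => n.
by have := congr1 (fun h : fps rat => h n.+1) e; rewrite !coef_fpsXMS.
Qed.

(** * Dyck paths of bounded height as paths in a strip *)

(** The starting level [l] is a parameter so that removing the first step leaves a path of the same
    kind; bounded Dyck paths are the case [l = 0]. *)
Fixpoint strip_path (k l : nat) (p : seq bool) : bool :=
  if p is b :: p' then
    if b then (l < k)%N && strip_path k l.+1 p'
    else (0 < l)%N && strip_path k l.-1 p'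
  else l == 0.

Fixpoint strip_count (k l m : nat) : nat :=
  if m is m'.+1 then
    ((if (l < k)%N then strip_count k l.+1 m' else 0)
     + (if (0 < l)%N then strip_count k l.-1 m' else 0))%N
  else (l == 0).

Lemma level_cons b p j :
  level (b :: p) j.+1 = (if b then 1 else -1) + level p j.
Proof. by rewrite /level /= big_cons. Qed.

Lemma level0 p : level p 0 = 0.
Proof. by rewrite /level take0 big_nil. Qed.

Lemma strip_pathP k l p : (l <= k)%N ->
  strip_path k l p =
    [forall j : 'I_(size p).+1, 0 <= l%:Z + level p j <= k%:Z]
    && (l%:Z + level p (size p) == 0).
Proof.
elim: p l => [|b p IHp] l lk.
  rewrite level0 addr0 /= andb_idl // => /eqP ->.
  by apply/forallP => j; rewrite ord1 level0.
have split_forall (Q : nat -> bool) n :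
    [forall j : 'I_n.+1, Q j] = Q 0%N && [forall j : 'I_n, Q j.+1].
  apply/forallP/andP => [h | [h0 /forallP h] j].
    by split; [exact: (h ord0) | apply/forallP => j; exact: (h (lift ord0 j))].
  by case: (unliftP ord0 j) => [i|] ->; [exact: (h i) | exact: h0].
rewrite (split_forall (fun j => 0 <= l%:Z + level (b :: p) j <= k%:Z)).
rewrite level0 addr0 /= !lez_nat lk /= level_cons.
under eq_forallb do rewrite level_cons addrA.
rewrite addrA; case: b.
  rewrite (_ : l%:Z + 1 = l.+1%:Z); last by lia.
  have [lk1|lk1] := ltnP l k; first by rewrite IHp.
  (* At the ceiling an up step leaves the strip immediately: position 0 of the remaining path
     violates the bound. *)
  by symmetry; apply/negbTE/andP => -[/forallP /(_ ord0)]; rewrite level0; lia.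
have [l0|l0] := ltnP 0 l.
  by rewrite (_ : l%:Z + -1 = l.-1%:Z) ?IHp //; lia.
by symmetry; apply/negbTE/andP => -[/forallP /(_ ord0)]; rewrite level0; lia.
Qed.

Lemma dyck_heightE k p : dyck p && (height p <= k%:Z) = strip_path k 0 p.
Proof.
rewrite strip_pathP // /dyck /height andbAC add0r; congr (_ && _).
apply/andP/forallP => [[/forallP h0 hk] j | h].
  by rewrite add0r h0 /=; apply: le_trans hk; exact: (le_bigmax _ _ j).
split; first by apply/forallP => j; have := h j; rewrite add0r => /andP [].
by apply: bigmax_le => // j _; have := h j; rewrite add0r => /andP [].
Qed.

Lemma big_tuple_cons m (F : seq bool -> nat) :
  (\sum_(p : m.+1.-tuple bool) F p
   = \sum_(p : m.-tuple bool) F (true :: p)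
     + \sum_(p : m.-tuple bool) F (false :: p))%N.
Proof.
rewrite (reindex (fun bp : bool * m.-tuple bool => [tuple of bp.1 :: bp.2])) /=.
  rewrite -(pair_bigA _ (fun b (p : m.-tuple bool) => F (b :: p))) /=.
  by rewrite big_bool.
exists (fun p => (thead p, [tuple of behead p])) => [[b p]|p] _ /=.
  by congr pair; apply: val_inj.
by rewrite -tuple_eta.
Qed.

Lemma card_strip_path k m l :
  #|[set p : m.-tuple bool | strip_path k l p]| = strip_count k l m.
Proof.
rewrite cardsE -sum1_card big_mkcond /=.
have E l' m' : (\sum_(p : m'.-tuple bool) strip_path k l' p
              = strip_count k l' m')%N.
  elim: m' l' => [|m' IHm] l'.
    by rewrite (big_pred1 [tuple]) // => p; apply/esym/eqP/tuple0.
  rewrite (big_tuple_cons _ (fun p => strip_path k l' p : nat)) /=.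
  by congr addn; case: ifP => _ /=; rewrite ?IHm // big1.
by rewrite -E; apply: eq_bigr => p _; rewrite unfold_in /=; case: strip_path.
Qed.

Lemma coef_G k n : G k%:Z n = (strip_count k 0 n.*2)%:R.
Proof.
rewrite /= -card_strip_path; congr (_%:R).
by apply: eq_card => p; rewrite !inE dyck_heightE.
Qed.

Lemma G_neg k : k < 0 -> G k = 0.
Proof.
move=> k0; apply: fpsP => n /=; rewrite (eq_card0 (A := _)) // => p.
rewrite !inE; apply/negbTE/andP => -[_ hk].
have h0 : 0 <= height p by apply: bigmax_ge_id.
by have := le_lt_trans (le_trans h0 hk) k0; rewrite ltxx.
Qed.

(** * Generating functions by starting level *)

Lemma strip_count_small k l m : (m < l)%N -> strip_count k l m = 0%N.
Proof.
elim: m l => [|m IHm] [|l] //= ml.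
by rewrite !IHm ?if_same //; lia.
Qed.

Lemma strip_countS k l m : strip_count k l m.+1 =
  ((if (l < k)%N then strip_count k l.+1 m else 0)
   + (if (0 < l)%N then strip_count k l.-1 m else 0))%N.
Proof. by []. Qed.

(* A path of length m from level l to level 0 has m = 2 n + l. *)
Definition strip_gf (k l : nat) : fps rat :=
  Fps (fun n => (strip_count k l (n.*2 + l))%:R).

Lemma coef_strip_gf k l n : strip_gf k l n = (strip_count k l (n.*2 + l))%:R.
Proof. by []. Qed.

Lemma strip_gf_top k : strip_gf k.+1 k.+1 = strip_gf k.+1 k.
Proof. by apply: fpsP => n; rewrite /= addnS /= ltnn. Qed.

(** Split by the first step. Going up raises the level by one and uses one step, so the remaining
    length exceeds the new level by two less: this is the factor x. Going down leaves the excess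
    unchanged. *)
Lemma strip_gf_mid k l : (l.+1 < k)%N ->
  strip_gf k l.+1 = fpsX * strip_gf k l.+2 + strip_gf k l.
Proof.
move=> lk; apply: fpsP => -[|n]; rewrite coef_fpsD ?coef_fpsXM0 ?coef_fpsXMS.
  (* A path whose length equals its starting level can only descend, so the up term vanishes. *)
  by rewrite /= lk strip_count_small // add0r.
have e m : (n.+1.*2 + m = n.*2 + m.+2)%N by lia.
by rewrite !coef_strip_gf -natrD !e addnS strip_countS lk.
Qed.

Lemma strip_gf_bot k : strip_gf k.+1 0 = fpsX * strip_gf k.+1 1 + 1.
Proof.
apply: fpsP => -[|n]; rewrite coef_fpsD ?coef_fpsXM0 ?coef_fpsXMS.
  by rewrite add0r.
by rewrite /= !addnS !addn0 /= addr0.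
Qed.

Lemma strip_gf00 : strip_gf 0 0 = 1.
Proof. by apply: fpsP => -[|n]. Qed.

Lemma G_strip k : G k%:Z = strip_gf k 0.
Proof. by apply: fpsP => n; rewrite coef_G /= addn0. Qed.

(** * The closed form of G_k *)

(** With f, g, h at consecutive descending roles (h one level above f, g one below), the ratio h / f
    determines f / g. After multiplying by 1 + C, the factor x (1 + C)^2 becomes C, and (1 + C) (1 -
    C^(j+2)) - C (1 - C^(j+1)) = 1 - C^(j+3). *)
Lemma ratio_step j (f g h : fps rat) :
  (1 - C ^+ j.+2) * h = (1 + C) * (1 - C ^+ j.+1) * f -> f = fpsX * h + g ->
  (1 - C ^+ j.+3) * f = (1 + C) * (1 - C ^+ j.+2) * g.
Proof.
move=> eh ef; apply: (mulrI unit_add1C).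
have -> : g = f - fpsX * h by rewrite ef; ring.
transitivity ((1 + C) ^+ 2 * (1 - C ^+ j.+2) * f
  - (fpsX * (1 + C) ^+ 2) * ((1 - C ^+ j.+2) * h)); last by ring.
by rewrite eh fpsXE !exprS; ring.
Qed.

(** Induction on the distance [j] from level l + 1 to the ceiling, starting at the ceiling where the
    two series coincide. *)
Lemma strip_gf_ratio j l :
  (1 - C ^+ j.+2) * strip_gf (l.+1 + j) l.+1
  = (1 + C) * (1 - C ^+ j.+1) * strip_gf (l.+1 + j) l.
Proof.
elim: j l => [|j IHj] l; first by rewrite addn0 strip_gf_top; ring.
rewrite -addSnnS; apply: (ratio_step (IHj l.+1)).
by apply: strip_gf_mid; lia.
Qed.

Lemma G_closed k : (1 - C ^+ k.+2) * G k%:Z = (1 + C) * (1 - C ^+ k.+1).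
Proof.
rewrite G_strip; case: k => [|k]; first by rewrite strip_gf00; ring.
(* At the bottom the empty path contributes 1, which takes the place of the series one level
   below. *)
rewrite -[RHS]mulr1; apply: ratio_step (strip_gf_bot k).
exact: (strip_gf_ratio k 0).
Qed.

Lemma coef_Cexp_small k j : (j < k)%N -> (C ^+ k) j = 0.
Proof. by apply: coef_fpsX_eq0; exact: C0. Qed.

Lemma coef_CexpM_small k j (f : fps rat) : (j < k)%N -> (C ^+ k * f) j = 0.
Proof.
move=> jk; rewrite coef_fpsM big1 // => i _.
by rewrite coef_Cexp_small ?mul0r //; have := ltn_ord i; lia.
Qed.

(** A path of semilength at most k has height at most k; here this is read off the closed form,
    where G_k differs from 1 + C by a multiple of C^(k+1). *)
Lemma coef_G_large k j : (j <= k)%N -> G k%:Z j = (1 + C) j.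
Proof.
move=> jk.
have e : G k%:Z = 1 + C + C ^+ k.+1 * (C * G k%:Z - (1 + C)).
  transitivity ((1 - C ^+ k.+2) * G k%:Z + C ^+ k.+2 * G k%:Z); first by ring.
  by rewrite G_closed !exprS; ring.
by rewrite e coef_fpsD coef_CexpM_small ?addr0.
Qed.

(** * Partial fractions for products of two G's *)

(** As functions of y, g and h each have a single pole, so their product is a linear combination of
    g, h and 1 with coefficients free of y. *)
Lemma homographic_mul (R : comUnitRingType) (q y a b g h : R) :
  1 - a * y * q \is a GRing.unit -> 1 - b * y * q \is a GRing.unit ->
  (1 - a * y * q) * g = (1 + q) * (1 - a * y) ->
  (1 - b * y * q) * h = (1 + q) * (1 - b * y) ->
  q * (a - b) * (g * h)
  = (1 + q) * ((q * a - b) * g + (a - q * b) * h - (1 + q) * (a - b)).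
Proof.
move=> ua ub eg eh; apply: (mulrI ua); apply: (mulrI ub).
transitivity (q * (a - b) * (((1 - a * y * q) * g) * ((1 - b * y * q) * h))).
  by ring.
transitivity ((1 + q) * ((q * a - b) * ((1 - a * y * q) * g) * (1 - b * y * q)
   + (a - q * b) * ((1 - b * y * q) * h) * (1 - a * y * q)
   - (1 + q) * (a - b) * (1 - a * y * q) * (1 - b * y * q))); last by ring.
by rewrite eg eh; ring.
Qed.

Lemma G_mul (n a i : nat) :
  C * (C ^+ a - C ^+ i) * (G (n + a)%:Z * G (n + i)%:Z)
  = (1 + C) * ((C * C ^+ a - C ^+ i) * G (n + a)%:Z
      + (C ^+ a - C * C ^+ i) * G (n + i)%:Z - (1 + C) * (C ^+ a - C ^+ i)).
Proof.
have e k : C ^+ k * C ^+ n.+1 = C ^+ (n + k).+1 by rewrite -exprD addnS addnC.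
(* Taking y = C^(n+1) puts all dependence on n into y. *)
by apply: (@homographic_mul _ C (C ^+ n.+1));
  rewrite e -?exprSr ?unit_sub1Cexp ?G_closed.
Qed.

(** Cross-multiplying the instances of [G_mul] for a and b and subtracting cancels the constant
    terms. The three remaining coefficients add up to zero, so only differences of G's occur. *)
Lemma G_diff_mul (a b i n : nat) :
  C * (C ^+ a - C ^+ i) * (C ^+ b - C ^+ i)
    * ((G (n + a)%:Z - G (n + b)%:Z) * G (n + i)%:Z)
  = (1 + C) * (C * C ^+ a - C ^+ i) * (C ^+ b - C ^+ i)
      * (G (n + a)%:Z - G (n + i)%:Z)
  - (1 + C) * (C * C ^+ b - C ^+ i) * (C ^+ a - C ^+ i)
      * (G (n + b)%:Z - G (n + i)%:Z).
Proof.
move: (G_mul n a i) (G_mul n b i).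
move: (G (n + a)%:Z) (G (n + i)%:Z) (G (n + b)%:Z) (C ^+ a) (C ^+ b)
  (C ^+ i) => ga gi gb ca cb ci ea eb.
transitivity ((cb - ci) * (C * (ca - ci) * (ga * gi))
  - (ca - ci) * (C * (cb - ci) * (gb * gi))); first by ring.
by rewrite ea eb; ring.
Qed.

(** * Rational functions of C *)

Implicit Types (f g S : fps rat) (t : nat -> fps rat).

(* The denominator d may vanish at 0, unlike in [rational_in]. *)
Definition ratio_in_C (f : fps rat) : Prop :=
  exists p d : {poly rat}, d != 0 /\ horner_alg C d * f = horner_alg C p.

Lemma ratio_poly p : ratio_in_C (horner_alg C p).
Proof. by exists p, 1; rewrite oner_neq0 rmorph1 mul1r. Qed.

Lemma ratioD f g :
  ratio_in_C f -> ratio_in_C g -> ratio_in_C (f + g).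
Proof.
move=> [p [d [d0 ef]]] [q [e [e0 eg]]]; exists (p * e + q * d), (d * e).
rewrite mulf_neq0 //; split=> //; rewrite rmorphD !rmorphM /= -ef -eg; ring.
Qed.

Lemma ratioM f g :
  ratio_in_C f -> ratio_in_C g -> ratio_in_C (f * g).
Proof.
move=> [p [d [d0 ef]]] [q [e [e0 eg]]]; exists (p * q), (d * e).
rewrite mulf_neq0 //; split=> //; rewrite !rmorphM /= -ef -eg; ring.
Qed.

Lemma ratio_cancel d f :
  d != 0 -> ratio_in_C (horner_alg C d * f) -> ratio_in_C f.
Proof.
move=> d0 [p [e [e0 ef]]]; exists p, (e * d).
by rewrite mulf_neq0 // rmorphM /= -mulrA.
Qed.

Lemma horner_C_cons p a :
  horner_alg C (p * 'X + a%:P) = horner_alg C p * C + a%:A.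
Proof. by rewrite rmorphD rmorphM /= horner_algX horner_algC. Qed.

Lemma coef0_horner_C p : horner_alg C p 0 = p`_0.
Proof.
elim/poly_ind: p => [|p a _]; first by rewrite rmorph0 coef0.
rewrite horner_C_cons coef_fpsD coef_fpsZ coef_fps1 mulr1 coefD coefMX coefC.
by rewrite coef_fpsM big_ord1 C0 mulr0.
Qed.

(** If the denominator vanishes at 0, so does the numerator, because p(C) has constant term p(0). A
    common factor C then cancels by [lreg_C], and the induction goes on with a shorter
    denominator. *)
Lemma rational_in_C f : ratio_in_C f -> rational_in C f.
Proof.
move=> [p [d [d0 e]]].
elim/poly_ind: d d0 p e => [|d a IHd] d0 p e; first by rewrite eqxx in d0.
have [a0|a0] := eqVneq a 0; last first.
  have u : horner_alg C (d * 'X + a%:P) \is a GRing.unit.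
    by rewrite fps_unitE coef0_horner_C coefD coefMX coefC add0r.
  by exists p, (d * 'X + a%:P); split; rewrite // -e mulrC mulKr.
move: d0 e; rewrite a0 addr0 rmorphM /= horner_algX => d0 e.
have {}d0 : d != 0 by apply: contraNneq d0 => ->; rewrite mul0r.
have /factor_theorem [q ep] : root p 0.
  rewrite rootE horner_coef0 -coef0_horner_C -e coef_fpsM big_ord1.
  by rewrite coef_fpsM big_ord1 C0 mulr0 mul0r.
apply: (IHd d0 q); apply: lreg_C; rewrite mulrA [C * _]mulrC e ep.
by rewrite subr0 rmorphM /= horner_algX mulrC.
Qed.

Lemma ratio_C : ratio_in_C C.
Proof. by rewrite -[C](horner_algX C); exact: ratio_poly. Qed.

Lemma ratio0 : ratio_in_C 0.
Proof. by rewrite -(rmorph0 (horner_alg C)); exact: ratio_poly. Qed.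

Lemma ratio1 : ratio_in_C 1.
Proof. by rewrite -(rmorph1 (horner_alg C)); exact: ratio_poly. Qed.

Lemma ratioN f : ratio_in_C f -> ratio_in_C (- f).
Proof.
by move=> [p [d [d0 e]]]; exists (- p), d; rewrite mulrN rmorphN e.
Qed.

Lemma ratio_G k : ratio_in_C (G k).
Proof.
have [k0|/gez0_abs <-] := ltP k 0; first by rewrite G_neg //; exact: ratio0.
set m := `|k|%N; exists ((1 + 'X) * (1 - 'X^(m.+1))), (1 - 'X^(m.+2)).
split; last first.
  rewrite rmorphM !(rmorphB, rmorphD) !rmorphXn /= !rmorph1 !horner_algX.
  exact: G_closed.
apply/eqP => /(congr1 (fun p : {poly rat} => p`_0)).
by rewrite coefB coef1 coefXn coef0 subr0.
Qed.

(** * Summation in the x-adic topology *)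

Lemma xadic_summableP t :
  (forall n j, (j < n)%N -> t n j = 0) -> exists S, xadic_sum t S.
Proof.
(* Only the terms with n <= j contribute to the coefficient of x^j. *)
move=> t0; exists (Fps (fun j => (\sum_(0 <= n < j.+1) t n) j)) => d.
exists d => n dn j jd /=; rewrite !coef_fps_sum.
rewrite (big_cat_nat (n := j.+1)) //=; last by lia.
rewrite -[RHS]addr0; congr (_ + _); rewrite big_nat_cond big1 //.
by move=> k /andP [/andP [jk _] _]; exact: t0.
Qed.

Lemma xadic_sum_uniq t S S' : xadic_sum t S -> xadic_sum t S' -> S = S'.
Proof.
move=> h h'; apply: fpsP => j; have [N hN] := h j.+1; have [N' hN'] := h' j.+1.
by rewrite -(hN (maxn N N')) ?leq_maxl // (hN' (maxn N N')) ?leq_maxr.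
Qed.

Lemma xadic_sumD t t' S S' : xadic_sum t S -> xadic_sum t' S' ->
  xadic_sum (fun n => t n + t' n) (S + S').
Proof.
move=> h h' d; have [N hN] := h d; have [N' hN'] := h' d.
exists (maxn N N') => n; rewrite geq_max => /andP [n1 n2] j jd.
by rewrite big_split !coef_fpsD /= hN ?hN'.
Qed.

Lemma xadic_sumMl f t S : xadic_sum t S -> xadic_sum (fun n => f * t n) (f * S).
Proof.
move=> h d; have [N hN] := h d; exists N => n Nn j jd.
rewrite -mulr_sumr !coef_fpsM; apply: eq_bigr => i _.
by rewrite hN //; apply: leq_ltn_trans jd; exact: leq_subr.
Qed.

Lemma xadic_sum_shift M t S : xadic_sum (fun n => t (n + M)%N) S ->
  xadic_sum t (\sum_(0 <= n < M) t n + S).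
Proof.
move=> h d; have [N hN] := h d; exists (N + M)%N => n Nn j jd.
rewrite (big_cat_nat (n := M)) //; last by lia.
rewrite !coef_fpsD -(hN (n - M)%N) //; last by lia.
by congr (_ + coefs _ _); rewrite -{1}[M]add0n big_addn.
Qed.

(** * Series whose sum is rational in C *)

Definition ratio_summable (t : nat -> fps rat) : Prop :=
  exists S, xadic_sum t S /\ ratio_in_C S.

Lemma eq_ratio_summable t t' :
  t =1 t' -> ratio_summable t -> ratio_summable t'.
Proof. by move=> /funext ->. Qed.

Lemma ratio_summableD t t' : ratio_summable t -> ratio_summable t' ->
  ratio_summable (fun n => t n + t' n).
Proof.
move=> [S [h r]] [S' [h' r']]; exists (S + S').
by split; [exact: xadic_sumD | exact: ratioD].
Qed.

Lemma ratio_summableMl f t : ratio_in_C f -> ratio_summable t ->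
  ratio_summable (fun n => f * t n).
Proof.
move=> rf [S [h r]]; exists (f * S).
by split; [exact: xadic_sumMl | exact: ratioM].
Qed.

(** Convergence of t is a separate premise because d(C) may be a non-unit; uniqueness of sums then
    equates d(C) S with the known rational sum. *)
Lemma ratio_summable_cancel d t : d != 0 -> (exists S, xadic_sum t S) ->
  ratio_summable (fun n => horner_alg C d * t n) -> ratio_summable t.
Proof.
move=> d0 [S h] [S' [h' r]]; exists S; split; first exact: h.
apply: (ratio_cancel d0).
by rewrite (xadic_sum_uniq (xadic_sumMl (horner_alg C d) h) h').
Qed.

Lemma ratio_summable_G_step a :
  ratio_summable (fun n => G (n + a.+1)%:Z - G (n + a)%:Z).
Proof.
exists (1 + C - G a%:Z); split; last first.
  apply: ratioD; last exact/ratioN/ratio_G.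
  by apply: ratioD; [exact: ratio1 | exact: ratio_C].
move=> d; exists d => n dn j jd.
under eq_bigr do rewrite addnS -addSn.
rewrite (telescope_sumr (fun n => G (n + a)%:Z)) // !coef_fpsB add0n.
by rewrite coef_G_large //; lia.
Qed.

Lemma ratio_summable_G a b :
  ratio_summable (fun n => G (n + a)%:Z - G (n + b)%:Z).
Proof.
have up k m : ratio_summable (fun n => G (n + (m + k))%:Z - G (n + m)%:Z).
  elim: k => [|k IHk].
    exists 0; split; last exact: ratio0.
    move=> d; exists 0%N => n _ j _; rewrite big1 // => i _.
    by rewrite addn0 subrr.
  apply: eq_ratio_summable (ratio_summableD (ratio_summable_G_step (m + k)) IHk).
  by move=> n; rewrite !addnS addrA subrK.
have [ba|/ltnW ab] := leqP b a; first by rewrite -(subnKC ba); exact: up.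
apply: eq_ratio_summable (ratio_summableMl (ratioN ratio1) (up (b - a)%N a)).
by move=> n /=; rewrite subnKC // mulN1r opprB.
Qed.

(** Induction on the factors: [G_diff_mul] trades the factor of index i for the differences of
    indices a, i and b, i, and distinctness passes to both shorter index lists. *)
Lemma ratio_summable_G_prod (a b : nat) (s : seq nat) :
  uniq [:: a, b & s] ->
  ratio_summable (fun n =>
    (G (n + a)%:Z - G (n + b)%:Z) * \prod_(i <- s) G (n + i)%:Z).
Proof.
elim: s a b => [|i s IHs] a b.
  move=> _; apply: eq_ratio_summable (ratio_summable_G a b) => n.
  by rewrite big_nil mulr1.
rewrite /= !inE !negb_or => /and4P [/and3P [ab ai a_s] /andP [bi b_s] i_s us].
have Xneq j : j != i -> 'X^j - 'X^i != 0 :> {poly rat}.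
  move=> ji; rewrite subr_eq0; apply: contra_neq ji.
  by move=> /(congr1 (size \o @polyseq rat)) /=; rewrite !size_polyXn => -[].
(* The multiplier is the one on the left of [G_diff_mul]; it is a nonzero polynomial because a and b
   differ from i. *)
apply: (@ratio_summable_cancel ('X * ('X^a - 'X^i) * ('X^b - 'X^i))).
- by rewrite !mulf_neq0 ?polyX_eq0 ?Xneq.
(* Below x^n both members of the difference agree with 1 + C, so the n-th term has order at least
   n. *)
- apply: xadic_summableP => n j jn; rewrite coef_fpsM big1 // => k _.
  have kn : (k < n)%N by have := ltn_ord k; lia.
  by rewrite coef_fpsB !coef_G_large ?subrr ?mul0r //; lia.
pose A := (1 + 'X) * ('X * 'X^a - 'X^i) * ('X^b - 'X^i) : {poly rat}.
pose B := - ((1 + 'X) * ('X * 'X^b - 'X^i) * ('X^a - 'X^i)) : {poly rat}.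
have ua : uniq [:: a, i & s] by rewrite /= inE negb_or ai a_s i_s.
have ub : uniq [:: b, i & s] by rewrite /= inE negb_or bi b_s i_s.
apply: eq_ratio_summable
  (ratio_summableD (ratio_summableMl (ratio_poly A) (IHs _ _ ua))
                   (ratio_summableMl (ratio_poly B) (IHs _ _ ub))) => n /=.
rewrite big_cons [(G _ - G _) * (_ * _)]mulrA [RHS]mulrA /A /B.
rewrite rmorphN !(rmorphM, rmorphB, rmorphD) !rmorphXn /= rmorph1 horner_algX.
by rewrite G_diff_mul; ring.
Qed.

(** * Reduction from integer to natural indices *)

Lemma seq_int_shift (s : seq int) :
  exists M : nat, forall i, i \in s -> 0 <= i + M%:Z.
Proof.
elim: s => [|i s [M hM]]; first by exists 0%N.
exists (M + `|i|)%N => k; rewrite inE => /predU1P [->|/hM]; lia.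
Qed.

Unset Implicit Arguments.
Set Strict Implicit.

Theorem theorem3p4 (i1 i1' : int) (s : seq int)
    (distinct : uniq [:: i1, i1' & s]) :
  exists S : fps rat,
    xadic_sum (fun n : nat =>
      (G (n%:Z + i1) - G (n%:Z + i1')) * \prod_(i <- s) G (n%:Z + i)) S
    /\ rational_in C S.
Proof.
have [M hM] := seq_int_shift [:: i1, i1' & s].
pose sh (i : int) := absz (i + M%:Z).
have shE i n : i \in [:: i1, i1' & s] -> ((n + sh i)%N)%:Z = (n + M)%N%:Z + i.
  by move=> /hM; rewrite /sh; lia.
pose t n := (G (n%:Z + i1) - G (n%:Z + i1')) * \prod_(i <- s) G (n%:Z + i).
have [S [h r]] : ratio_summable (fun n => t (n + M)%N).
  apply: (@eq_ratio_summable (fun n => (G (n + sh i1)%:Z - G (n + sh i1')%:Z)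
      * \prod_(i <- map sh s) G (n + i)%:Z)) => [n|].
    rewrite /t big_map !shE ?inE ?eqxx ?orbT //; congr (_ * _).
    by apply: eq_big_seq => i si; rewrite shE // !inE si !orbT.
  apply: ratio_summable_G_prod; rewrite -!map_cons map_inj_in_uniq //.
  by move=> i j /hM hi /hM hj; rewrite /sh; lia.
(* The first M terms are finite products and differences of G's, each rational in C by [ratio_G],
   including the zero series at negative indices. *)
exists (\sum_(0 <= n < M) t n + S); split; first exact: xadic_sum_shift.
apply/rational_in_C/ratioD => //.
elim/big_ind: _ => [||n _]; [exact: ratio0 | exact: ratioD |].
apply: ratioM; first by apply: ratioD; [|apply: ratioN]; exact: ratio_G.
by elim/big_ind: _ => [||i _]; [exact: ratio1 | exact: ratioM | exact: ratio_G].
Qed.
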